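(* Let $Z_1$ be the set of network sequences $(\Omega_N)_{N}$ that are SWD, and let $Z_2$ be the set of network sequences $(\Omega_N)_{N}$ that are DSWL. Then $Z_1\cap Z_2\neq\emptyset$.
   Context: A network is a finite, simple, undirected, connected graph. A network sequence is a sequence $(\Omega_N)_{N}$ in which $\Omega_N$ is a network with exactly $N$ nodes (the first few values of $N$ are irrelevant for the limits below). Write $\delta_1(\Omega_N)$ for the largest node degree of $\Omega_N$, and $d_N$ for the diameter of $\Omega_N$, i.e. the maximum shortest-path distance between two nodes of $\Omega_N$. $(\Omega_N)$ is SWD if there is a finite constant $C\ge 0$ with $\lim_{N\to\infty} d_N/\ln(N)=C$. $(\Omega_N)$ is DSWL if $\lim_{N\to\infty}\delta_1(\Omega_N)/\ln(N)=+\infty$. *)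

(* Defs.v *)
From HB Require Import structures.
From mathcomp Require Import all_boot all_order all_algebra.
From mathcomp Require Import all_classical all_reals all_analysis.
Set Implicit Arguments.
Unset Strict Implicit.
Unset Printing Implicit Defensive.
Import Order.TTheory GRing.Theory Num.Theory.
Import numFieldNormedType.Exports.
Local Open Scope classical_set_scope.
Local Open Scope ring_scope.

Record network (V : finType) := Network {
  adj :> rel V;
  adj_sym : symmetric adj;
  adj_irr : irreflexive adj;
  adj_conn : forall x y : V, connect adj x y }.

Section NetworkParameters.
Variables (V : finType) (G : network V).
Implicit Types x y : V.

Definition degree x : nat := #|[pred y | G x y]|.

Definition max_degree : nat := (\max_(x : V) degree x)%N.

Definition joined_by x y (n : nat) : bool :=
  [exists p : n.-tuple V, path G x p && (last x p == y)].

Lemma joined_by_ex x y : exists n, joined_by x y n.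
Proof.
have /connectP[p xp ->] := adj_conn G x y.
by exists (size p); apply/existsP; exists (in_tuple p); rewrite xp eqxx.
Qed.

Definition dist x y : nat := ex_minn (joined_by_ex x y).

Definition diameter : nat := (\max_(x : V) \max_(y : V) dist x y)%N.

End NetworkParameters.

(* The nodes of the N-th network are labelled by 'I_N.  At N = 0 the only
   possibility is the empty network, which is vacuously connected; neither this
   term nor the quotients by ln 0 = ln 1 = 0 matter for the limits below. *)
Definition network_sequence : Type := forall N : nat, network 'I_N.

Definition SWD (R : realType) : set network_sequence :=
  [set Omega | exists2 C : R, 0 <= C &
     (fun N : nat => (diameter (Omega N))%:R / ln (N%:R : R)) @ \oo --> C].

Definition DSWL (R : realType) : set network_sequence :=
  [set Omega |
     (fun N : nat => (max_degree (Omega N))%:R / ln (N%:R : R)) @ \oo --> +oo].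

(* Main.v *)
(* The complete graphs work: their diameters are at most 1, while their degrees
   N - 1 outgrow ln N, because exp t >= 1 + t ^ 2 / 2 at t = ln N gives
   (N - 1) / ln N >= ln N / 2. *)
Require Import Defs.
From HB Require Import structures.
From mathcomp Require Import all_boot all_order all_algebra.
From mathcomp Require Import all_classical all_reals all_analysis.
Set Implicit Arguments.
Unset Strict Implicit.
Unset Printing Implicit Defensive.
Import Order.TTheory GRing.Theory Num.Theory.
Import numFieldNormedType.Exports.
Local Open Scope classical_set_scope.
Local Open Scope ring_scope.

(** SWD admits the constant 0, so a sequence of bounded diameter qualifies, and nothing then
    prevents the degrees from being as large as possible. For the complete graphs,
    [diameter_complete] squeezes the first quotient between 0 and 1 / ln N, while
    [max_degree_complete] and [ln_div2_le] bound the second below by ln N / 2. Both limits thus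
    reduce to [cvg_ln_natr]. *)

Section Complete.
Variable V : finType.

Definition complete_adj : rel V := fun x y => x != y.

Lemma complete_adj_sym : symmetric complete_adj.
Proof. by move=> x y; rewrite /complete_adj eq_sym. Qed.

Lemma complete_adj_irr : irreflexive complete_adj.
Proof. by move=> x; rewrite /complete_adj eqxx. Qed.

Lemma complete_adj_conn (x y : V) : connect complete_adj x y.
Proof. by have [->|xy] := eqVneq x y; [exact: connect0 | exact: connect1]. Qed.

Definition complete_network : network V :=
  Network complete_adj_sym complete_adj_irr complete_adj_conn.

(** [dist] is a least walk length, so it suffices to exhibit the empty walk or a single edge. The
    bound is not an equality: with at most one node the diameter is 0. *)
Lemma diameter_complete : (diameter complete_network <= 1)%N.
Proof.
apply/bigmax_leqP => x _; apply/bigmax_leqP => y _.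
rewrite /dist; case: ex_minnP => m _ min_m.
have [xy|xy] := eqVneq x y.
  apply: leq_trans (leq0n 1); apply: min_m.
  by apply/existsP; exists [tuple]; rewrite /= xy.
by apply: min_m; apply/existsP; exists [tuple y]; rewrite /= /complete_adj xy eqxx.
Qed.

Lemma degree_complete (x : V) : degree complete_network x = #|V|.-1.
Proof. by rewrite -(cardC1 x); apply: eq_card => y; rewrite !inE /= eq_sym. Qed.

Lemma max_degree_complete : max_degree complete_network = #|V|.-1.
Proof.
rewrite /max_degree; under eq_bigr do rewrite degree_complete.
(* For empty [V] the maximum is 0, and so is the truncated predecessor of 0. *)
case: (pickP V) => [x _|V0]; last by rewrite big_pred0 ?eq_card0.
apply/eqP; rewrite eqn_leq (bigop.bigmax_sup x) // andbT.
by apply/bigmax_leqP.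
Qed.

End Complete.

Lemma cvg_ln_natr (R : realType) : ln (n%:R : R) @[n --> \oo] --> +oo.
Proof.
apply/cvgryPge => A; near=> n.
(* With A written as ln (exp A), monotonicity of [ln] leaves exp A <= n. *)
rewrite -(expRK A) ler_ln ?posrE ?expR_gt0 ?ltr0n //; last by near: n; exact: nbhs_infty_gt.
by near: n; move/cvgryPge: (@cvgr_idn R); exact.
Unshelve. all: by end_near. Qed.

Lemma ln_div2_le (R : realType) (n : nat) :
  (1 < n)%N -> ln n%:R / 2 <= n.-1%:R / ln n%:R :> R.
Proof.
move=> n_gt1; have ln_n_gt0 : 0 < ln n%:R :> R by rewrite ln_gt0 // ltr1n.
rewrite ler_pdivlMr // mulrAC -expr2 -subn1 natrB ?(ltnW n_gt1) // lerBrDl.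
(* The index 1 selects the quadratic term: 1 + t ^ 2 / 2! <= exp t at t = ln n. *)
have := expR_ge1Dxn 1 (ltW ln_n_gt0).
by rewrite lnK // posrE ltr0n (ltnW n_gt1).
Qed.

Theorem proposition2 (R : realType) : SWD R `&` DSWL R !=set0.
Proof.
exists (fun N => complete_network 'I_N); split.
  exists 0 => //; apply: (@squeeze_cvgr _ _ _ _ (fun=> 0) (fun n : nat => (ln (n%:R : R))^-1)).
  - near=> n.
    have ln_n_gt0 : 0 < ln n%:R :> R.
      by rewrite ln_gt0 // ltr1n; near: n; exact: nbhs_infty_gt.
    rewrite divr_ge0 ?(ltW ln_n_gt0) //= ler_pdivrMr // mulVf ?gt_eqF //.
    by rewrite lern1 diameter_complete.
  - exact: cvg_cst.
  - apply: (iffRL (gtr0_cvgV0 _)); last exact: cvg_ln_natr.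
    by near=> n; rewrite ln_gt0 // ltr1n; near: n; exact: nbhs_infty_gt.
apply: (@ger_cvgy _ _ _ _ (fun n : nat => ln (n%:R : R) / 2)).
  near=> n; rewrite max_degree_complete card_ord; apply: ln_div2_le.
  by near: n; exact: nbhs_infty_gt.
(* The function scaled by 1/2 is [id], along the image of [\oo] under [ln]. *)
apply: (@gt0_cvgMly R (ln n%:R @[n --> \oo]) _ 2^-1 id); first by rewrite invr_gt0.
exact: cvg_ln_natr.
Unshelve. all: by end_near. Qed.
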